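(* Let $f=\frac1n\sum_{i=1}^n f_i$ where each $f_i:\mathbb{R}^d\to\mathbb{R}$ is convex and $L_i$-smooth, assume that $f$ is $\mu$-strongly convex ($\mu>0$) with minimizer $x^*$, and let $L_{\max}=\max_{1\le i\le n}L_i$. Assume interpolation, i.e. $\sigma=0$. Then the iterates of SGD with SPS with $c=1/2$ satisfy, for all $k\ge0$, $$\mathbb{E}\|x^{k}-x^*\|^2\le\left(1-\frac{\mu}{L_{\max}}\right)^k\|x^0-x^*\|^2.$$
   Context: Setting: $f(x)=\frac1n\sum_{i=1}^n f_i(x)$ is minimized over $\mathbb{R}^d$, and the set $\mathcal{X}^*$ of minimizers of $f$ is nonempty. A function is $L$-smooth if it is differentiable with $L$-Lipschitz gradient. For each $i$, $f_i^*:=\inf_x f_i(x)$, and it is assumed throughout that $\sigma^2:=\mathbb{E}_i[f_i(x^* )-f_i^*]=f(x^* )-\frac1n\sum_{i=1}^n f_i^*<\infty$ (so all $f_i^*$ are finite), where $x^*\in\mathcal{X}^*$. SGD: starting from a deterministic $x^0$, at each iteration $k$ an index $i\in\{1,\dots,n\}$ is drawn uniformly at random, independently of the past, and $x^{k+1}=x^k-\gamma_k\nabla f_i(x^k)$. SPS with parameter $c>0$: $\gamma_k=\frac{f_i(x^k)-f_i^*}{c\|\nabla f_i(x^k)\|^2}$, where $i$ is the index drawn at iteration $k$ (no upper bound is imposed on the step-size). If $\nabla f_i(x^k)=0$ then $x^{k+1}=x^k$. *)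

(* Defs.v *)
From mathcomp Require Export all_boot all_order all_algebra.
From mathcomp Require Export all_classical all_reals all_analysis.
Export Order.TTheory GRing.Theory Num.Theory.
Export numFieldNormedType.Exports.

Set Implicit Arguments.
Unset Strict Implicit.
Unset Printing Implicit Defensive.

Local Open Scope classical_set_scope.
Local Open Scope ring_scope.

(* The library's norm on 'rV[R]_d is the sup norm; the Euclidean norm is needed
   here. The two induce the same topology, so the library's [differentiable]
   is unaffected by the choice. *)
Definition enorm (R : realType) (d : nat) (x : 'rV[R]_d) : R :=
  Num.sqrt (\sum_(j < d) x 0 j ^+ 2).

Definition grad (R : realType) (d : nat) (f : 'rV[R]_d -> R) (x : 'rV[R]_d) :
    'rV[R]_d :=
  \row_(j < d) 'D_(delta_mx 0 j) f x.

Definition smooth (R : realType) (d : nat) (L : R) (f : 'rV[R]_d -> R) : Prop :=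
  (forall x, differentiable f x) /\
  (forall x y, enorm (grad f x - grad f y) <= L * enorm (x - y)).

Definition strongly_convex (R : realType) (d : nat) (mu : R)
    (f : 'rV[R]_d -> R) : Prop :=
  forall (x y : 'rV[R]_d) (t : R), 0 <= t <= 1 ->
    f (t *: x + (1 - t) *: y) <=
      t * f x + (1 - t) * f y
      - mu / 2 * (t * (1 - t)) * enorm (x - y) ^+ 2.

Definition favg (R : realType) (n d : nat) (f : 'I_n.+1 -> 'rV[R]_d -> R)
    (x : 'rV[R]_d) : R :=
  n.+1%:R^-1 * \sum_(i < n.+1) f i x.

Definition minimizer (R : realType) (d : nat) (f : 'rV[R]_d -> R)
    (x : 'rV[R]_d) : Prop :=
  forall y, f x <= f y.

(* [inf] is a junk value on sets that are not bounded below, so finiteness has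
   to be assumed separately, as [has_lbound (range f)]. *)
Definition infval (R : realType) (d : nat) (f : 'rV[R]_d -> R) : R :=
  inf (range f).

Definition sigma2 (R : realType) (n d : nat) (f : 'I_n.+1 -> 'rV[R]_d -> R)
    (xs : 'rV[R]_d) : R :=
  n.+1%:R^-1 * \sum_(i < n.+1) (f i xs - infval (f i)).

(* When the gradient vanishes this is 0 (as 0^-1 = 0); the value is irrelevant,
   since [sgd] multiplies it by that gradient and hence does not move. *)
Definition sps (R : realType) (d : nat) (c : R) (f : 'rV[R]_d -> R)
    (x : 'rV[R]_d) : R :=
  (f x - infval f) / (c * enorm (grad f x) ^+ 2).

(* The k-th iterate along the sequence of drawn indices [s]. *)
Fixpoint sgd (R : realType) (n d : nat) (f : 'I_n.+1 -> 'rV[R]_d -> R)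
    (gamma : ('rV[R]_d -> R) -> 'rV[R]_d -> R) (x0 : 'rV[R]_d)
    (s : nat -> 'I_n.+1) (k : nat) : 'rV[R]_d :=
  if k is k'.+1 then
    let x := sgd f gamma x0 s k' in
    x - gamma (f (s k')) x *: grad (f (s k')) x
  else x0.

(* Measurability is with respect to the discrete sigma-algebra on 'I_n.+1. *)
Definition iid_uniform (R : realType) (n : nat) (disp : measure_display)
    (T : measurableType disp) (P : probability T R)
    (I : nat -> T -> 'I_n.+1) : Prop :=
  [/\ forall k (i : 'I_n.+1), measurable (I k @^-1` [set i]),
      forall k (i : 'I_n.+1), P (I k @^-1` [set i]) = (n.+1%:R^-1)%:E
    & forall (J : seq nat) (A : nat -> set 'I_n.+1), uniq J ->
        P (\bigcap_(k in [set` J]) (I k @^-1` A k)) =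
        (\prod_(k <- J) P (I k @^-1` A k))%E ].

(* Main.v *)
(* Interpolation makes xs a common minimizer of all f_i. Convexity and smoothness
   then give <grad f_i(x), x - xs> >= (f_i(x) - f_i(xs)) + |grad f_i(x)|^2 / (2L),
   and for c = 1/2 the remaining first- and second-order terms of the step cancel,
   leaving |x' - xs|^2 <= |x - xs|^2 - (2 / L) (f_i(x) - f_i(xs)). Averaging over i
   and using strong convexity contracts the squared distance by 1 - mu / L. The
   k-th iterate depends on the first k indices only, so its expectation is a
   uniform average over k-tuples of indices. *)
Require Import Defs.
From mathcomp Require Import ring lra.

Set Implicit Arguments.
Unset Strict Implicit.
Unset Printing Implicit Defensive.

Local Open Scope classical_set_scope.
Local Open Scope ring_scope.

(** * Inner product behind the Euclidean norm *)

Section euclidean.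
Context {R : realType} {d : nat}.
Implicit Types (u v w : 'rV[R]_d) (a : R).

Definition dot u v : R := \sum_(j < d) u 0 j * v 0 j.

Lemma dotC u v : dot u v = dot v u.
Proof. by apply: eq_bigr => j _; rewrite mulrC. Qed.

Lemma dotDl u v w : dot (u + v) w = dot u w + dot v w.
Proof. by rewrite -big_split; apply: eq_bigr => j _; rewrite !mxE mulrDl. Qed.

Lemma dotZl a u v : dot (a *: u) v = a * dot u v.
Proof. by rewrite mulr_sumr; apply: eq_bigr => j _; rewrite !mxE mulrA. Qed.

Lemma dotNl u v : dot (- u) v = - dot u v.
Proof. by rewrite -scaleN1r dotZl mulN1r. Qed.

Lemma dotDr u v w : dot u (v + w) = dot u v + dot u w.
Proof. by rewrite dotC dotDl !(dotC u). Qed.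

Lemma dotZr a u v : dot u (a *: v) = a * dot u v.
Proof. by rewrite dotC dotZl dotC. Qed.

Lemma dotNr u v : dot u (- v) = - dot u v.
Proof. by rewrite dotC dotNl dotC. Qed.

Definition dotE := (dotDl, dotDr, dotNl, dotNr, dotZl, dotZr).

Lemma enorm_ge0 u : 0 <= enorm u.
Proof. exact: sqrtr_ge0. Qed.

Lemma enorm_sqr u : enorm u ^+ 2 = dot u u.
Proof.
rewrite sqr_sqrtr; last by apply: sumr_ge0 => j _; exact: sqr_ge0.
by apply: eq_bigr => j _; rewrite expr2.
Qed.

Lemma dotvv_ge0 u : 0 <= dot u u.
Proof. by rewrite -enorm_sqr sqr_ge0. Qed.

Lemma dotvv_eq0 u : dot u u = 0 -> u = 0.
Proof.
move=> /psumr_eq0P u0; apply/rowP => j; rewrite mxE.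
by apply/eqP; rewrite -sqrf_eq0 expr2 u0// => i _; rewrite -expr2 sqr_ge0.
Qed.

(** Stands in for Cauchy-Schwarz: expanding $\|u-av\|^2\ge0$ gives $2a\langle
    u,v\rangle\le\|u\|^2+a^2\|v\|^2\le2a^2\|v\|^2$. *)
Lemma dot_le_of_enorm u v a : 0 < a -> enorm u <= a * enorm v ->
  dot u v <= a * dot v v.
Proof.
move=> a0; rewrite -ler_sqr ?nnegrE ?mulr_ge0 ?enorm_ge0 ?(ltW a0)//.
rewrite exprMn !enorm_sqr => uv.
have := dotvv_ge0 (u - a *: v); rewrite !dotE (dotC v u) => uav.
by rewrite -(ler_pM2l a0); nra.
Qed.

End euclidean.

(** * First-order inequalities for convex and smooth functions *)

Section directional_derivative.
Context {R : realType} {d : nat}.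
Implicit Types (f : 'rV[R]_d -> R) (x v : 'rV[R]_d).

Lemma derive_dot_grad f x v : differentiable f x -> 'D_v f x = dot (grad f x) v.
Proof.
move=> df; rewrite deriveE// {1}(row_sum_delta v) linear_sum.
by apply: eq_bigr => j _; rewrite linearZ/= mxE deriveE// mulrC.
Qed.

Lemma is_derive_line f x v (t : R) : differentiable f (x + t *: v) ->
  is_derive t 1 (fun s : R => f (x + s *: v)) (dot (grad f (x + t *: v)) v).
Proof.
move=> df.
have E : (fun h : R => h^-1 *: (((fun s : R => f (x + s *: v)) \o shift t)
    (h *: 1) - f (x + t *: v))) =
  (fun h : R => h^-1 *: ((f \o shift (x + t *: v)) (h *: v) - f (x + t *: v))).
  apply/funext => h /=; congr (_ *: (f _ - _)).
  by rewrite [h *: 1]mulr1 scalerDl addrCA.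
apply: DeriveDef; first by rewrite /derivable E; exact: diff_derivable.
by rewrite /derive E -derive_dot_grad.
Qed.

(** The two-sided limit defining the derivative equals the right-hand one, whose difference
    quotients are at most [c]. *)
Lemma dot_grad_le f x v (c : R) : differentiable f x ->
  (forall t : R, 0 < t < 1 -> f (x + t *: v) - f x <= t * c) ->
  dot (grad f x) v <= c.
Proof.
move=> df fc; rewrite -derive_dot_grad// /derive.
have cv : cvg (h^-1 *: ((f \o shift x) (h *: v) - f x) @[h --> (0:R)^']).
  exact: diff_derivable.
have cvr := @cvg_dnbhs_at_right _ _ _ _ _ cv.
rewrite -(cvg_lim _ cvr)//; apply: limr_le.
  by apply/cvg_ex; eexists; exact: cvr.
near=> h.
have h0 : 0 < h by near: h; exact: nbhs_right_gt.
have h1 : h < 1 by near: h; exact: nbhs_right_lt.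
rewrite -[leLHS]/(h^-1 * _) ler_pdivrMl//= [_ + x]addrC; apply: fc; exact/andP.
Unshelve. all: by end_near. Qed.

Lemma convex_grad_le f x y : convex_function [set: 'rV[R]_d] f ->
  differentiable f x -> f x + dot (grad f x) (y - x) <= f y.
Proof.
move=> cf df; rewrite -lerBrDl; apply: dot_grad_le => // t /andP[t0 t1].
have t01 : Itv.spec (@Itv.num_sem R) (Itv.Real `[0%Z, 1%Z]) t.
  by rewrite /Itv.spec/= /Itv.num_sem/= num_real/= in_itv/= (ltW t0) (ltW t1).
have := cf (Itv.mk t01) y x (in_setT _) (in_setT _).
rewrite convRE /conv/= /unstable.onem.
rewrite (_ : _ *: y + _ = x + t *: (y - x)).
  by move=> H; rewrite lerBlDr (le_trans H)//; lra.
by rewrite scalerBl scale1r scalerBr addrCA addrA.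
Qed.

(** Fermat's rule along the line through [x] in the direction [grad f x], where the derivative at
    $0$ is $\|\nabla f(x)\|^2$. *)
Lemma grad_minimizer f x : (forall y, differentiable f y) -> minimizer f x ->
  grad f x = 0.
Proof.
move=> df fx; apply: dotvv_eq0.
have D s := is_derive_line (df (x + s *: grad f x)).
have /(@derive_val _ _ _ _ _ _ _) D0 :
    is_derive (0 : R) 1 (fun s : R => f (x + s *: grad f x)) 0.
  apply: (@derive1_at_min _ _ (-1) 1); rewrite ?in_itv/=; [lra| |lra|].
    by move=> t _; exact: (@ex_derive _ _ _ _ _ _ _ (D t)).
  by move=> t _; rewrite scale0r addr0; exact: fx.
by rewrite -[RHS]D0 (@derive_val _ _ _ _ _ _ _ (D 0)) scale0r addr0.
Qed.

Lemma smooth_minimizer_le (L : R) f x v : 0 < L -> smooth L f ->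
  minimizer f x -> f (x + v) <= f x + L / 2 * dot v v.
Proof.
move=> L0 [df Lf] fx; have gx := grad_minimizer df fx.
pose K := L / 2 * dot v v.
(* The mean value theorem for $s\mapsto f(x+sv)$ alone would lose a factor 2. Subtracting $Ks^2$
   first leaves the bound $\langle\nabla f(x+tv),v\rangle\le Lt\|v\|^2$ to prove, which follows from
   [grad f x = 0]. *)
pose psi (s : R) := f (x + s *: v) - K * s ^+ 2.
pose dpsi (s : R) := dot (grad f (x + s *: v)) v - K * (2 * s).
have D (s : R) : is_derive s 1 psi (dpsi s).
  have D1 := is_derive_line (df (x + s *: v)).
  apply: is_deriveB; apply: is_derive_eq.
  by rewrite /GRing.scale/=; ring.
have [|t] := @MVT R psi dpsi 0 1 ltr01 (fun s _ => D s).
  apply: continuous_subspaceT => s.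
  by apply: differentiable_continuous; apply/derivable1_diffP; case: (D s).
rewrite in_itv/= => /andP[t0 _].
rewrite /psi /dpsi /K scale1r scale0r addr0.
suff : dot (grad f (x + t *: v)) v <= L * t * dot v v by lra.
apply: dot_le_of_enorm; first exact: mulr_gt0.
have := Lf (x + t *: v) x; rewrite gx subr0 [x + _]addrC addrK.
suff -> : enorm (t *: v) = t * enorm v by rewrite mulrA.
apply/eqP; rewrite -(@eqrXn2 _ 2) ?mulr_ge0 ?enorm_ge0 ?(ltW t0)//.
by rewrite exprMn !enorm_sqr !dotE; apply/eqP; ring.
Qed.

(* Compare [f] at [xs + L^-1 *: grad f x], from above by smoothness at [xs]
   and from below by convexity at [x]. *)
Lemma smooth_convex_grad_ge (L : R) f x xs : 0 < L -> smooth L f ->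
  convex_function [set: 'rV[R]_d] f -> minimizer f xs ->
  f x - f xs + dot (grad f x) (grad f x) / (2 * L) <= dot (grad f x) (x - xs).
Proof.
move=> L0 sf cf fxs; have [df _] := sf.
have := smooth_minimizer_le (L^-1 *: grad f x) L0 sf fxs.
have := convex_grad_le (xs + L^-1 *: grad f x) cf (df x).
rewrite !dotE.
set G := dot (grad f x) (grad f x); set a := dot _ x; set b := dot _ xs.
have -> : L / 2 * (L^-1 * (L^-1 * G)) = G / (2 * L) by field; lra.
have -> : L^-1 * G = G / (2 * L) + G / (2 * L) by field; lra.
lra.
Qed.

End directional_derivative.

(** * One SPS step, and quadratic growth around a minimizer *)

Section sps_descent.
Context {R : realType} {d : nat}.
Implicit Types (f : 'rV[R]_d -> R) (x xs : 'rV[R]_d).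

Lemma smooth_le (L L' : R) f : L <= L' -> smooth L f -> smooth L' f.
Proof.
move=> LL' [df Lf]; split => // x y; apply: le_trans (Lf x y) _.
by rewrite ler_wpM2r// enorm_ge0.
Qed.

Lemma sps_step_le (L : R) f x xs : 0 < L -> smooth L f ->
  convex_function [set: 'rV[R]_d] f -> minimizer f xs -> f xs = infval f ->
  enorm (x - sps 2^-1 f x *: grad f x - xs) ^+ 2 <=
  enorm (x - xs) ^+ 2 - 2 / L * (f x - f xs).
Proof.
move=> L0 sf cf fxs fE.
have := smooth_convex_grad_ge x L0 sf cf fxs.
rewrite !enorm_sqr [x - _ - xs]addrAC /sps -fE enorm_sqr.
have := fxs x; rewrite -subr_ge0.
set D := f x - f xs; set g := grad f x; set G := dot g g => D0.
have [G0|Gn0] := eqVneq G 0.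
  (* At a zero gradient the iterate does not move, and the gradient inequality forces [D = 0]. *)
  have /dotvv_eq0 g0 : dot g g = 0 by [].
  rewrite G0 g0 scaler0 subr0 -[0 : 'rV_d](scale0r 0) dotZl !mul0r addr0 => Dle.
  have -> : D = 0 by apply/le_anti/andP.
  by rewrite mulr0 subr0.
set b := dot g (x - xs); set gam := D / _ => H.
have G0 : 0 < G by rewrite lt_def Gn0 dotvv_ge0.
(* Here $c=1/2$ enters: the second-order term [gam * (gam * G)] becomes [2 * gam * D], exactly what
   the lower bound on [b] pays for. *)
have gamG : gam * G = 2 * D by rewrite /gam; field.
have gam0 : 0 <= gam by rewrite /gam divr_ge0// mulr_ge0// ltW.
have -> : dot (x - xs - gam *: g) (x - xs - gam *: g) =
    dot (x - xs) (x - xs) - 2 * gam * b + gam * (gam * G).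
  move: (x - xs) @b H => z b _; rewrite !dotE (dotC z g) -/b -/G; ring.
rewrite gamG.
have -> : 2 / L * D = gam * (2 * (G / (2 * L))).
  by rewrite mulrAC -gamG; field; lra.
move/(ler_wpM2l gam0): H; lra.
Qed.

Lemma strongly_convex_minimizer (mu : R) f x xs :
  strongly_convex mu f -> minimizer f xs ->
  mu / 2 * enorm (x - xs) ^+ 2 <= f x - f xs.
Proof.
move=> scf fxs; set Q := mu / 2 * _.
have H (t : R) : 0 < t < 1 -> Q <= f x - f xs + t * Q.
  move=> /andP[t0 t1]; have := scf x xs t; rewrite (ltW t0) (ltW t1) => /(_ isT).
  move=> /(le_trans (fxs _)) H; rewrite -(ler_pM2l t0) -/Q.
  by move: H; rewrite /Q; lra.
have [Q0|Q0] := leP Q 0; first by rewrite (le_trans Q0)// subr_ge0.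
apply/ler_addgt0Pr => e e0.
(* Chosen so that [t < 1] and [t * Q <= e]. *)
pose t := Num.min 2^-1 (e / Q).
have t0 : 0 < t by rewrite /t lt_min invr_gt0 ltr0n divr_gt0.
have t1 : t < 1 by rewrite /t gt_min; apply/orP; left; lra.
apply: (le_trans (H t _)); first by rewrite t0.
by rewrite lerD2l -ler_pdivlMr// /t ge_min lexx orbT.
Qed.

End sps_descent.

(** * Dependence of the iterates on the index sequence *)

Lemma sgd_shift (R : realType) (n d : nat) (f : 'I_n.+1 -> 'rV[R]_d -> R)
    gamma x0 (s : nat -> 'I_n.+1) k :
  sgd f gamma x0 s k.+1 =
  sgd f gamma (x0 - gamma (f (s 0%N)) x0 *: grad (f (s 0%N)) x0)
    (fun j => s j.+1) k.
Proof. by elim: k => //= k ->. Qed.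

Lemma sgd_ext (R : realType) (n d : nat) (f : 'I_n.+1 -> 'rV[R]_d -> R)
    gamma x0 (s s' : nat -> 'I_n.+1) k :
  (forall j, (j < k)%N -> s j = s' j) ->
  sgd f gamma x0 s k = sgd f gamma x0 s' k.
Proof.
elim: k => //= k IH ss'; rewrite IH ?ss'// => j jk.
by rewrite ss'// ltnS ltnW.
Qed.

Lemma big_tupleS (R : nmodType) (T : finType) (k : nat)
    (F : k.+1.-tuple T -> R) :
  \sum_(s : k.+1.-tuple T) F s =
  \sum_(i : T) \sum_(s : k.-tuple T) F [tuple of i :: s].
Proof.
rewrite pair_big (reindex (fun p : T * k.-tuple T => [tuple of p.1 :: p.2]))//=.
exists (fun s : k.+1.-tuple T => (thead s, [tuple of behead s])) => [[i s]|s] _.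
  by congr (_, _); apply/val_inj.
by rewrite [RHS]tuple_eta.
Qed.

(** * Contraction of the squared distance, summed over indices *)

Section interpolation.
Context {R : realType} {n d : nat}.
Variables (f : 'I_n.+1 -> 'rV[R]_d -> R) (L mu : R) (xs : 'rV[R]_d).
Hypothesis f_convex : forall i, convex_function [set: 'rV[R]_d] (f i).
Hypothesis L_gt0 : 0 < L.
Hypothesis f_smooth : forall i, smooth L (f i).
Hypothesis favg_sc : strongly_convex mu (favg f).
Hypothesis xs_min : forall i, minimizer (f i) xs.
Hypothesis xs_inf : forall i, f i xs = infval (f i).

Let rho := 1 - mu / L.

Lemma favg_minimizer : minimizer (favg f) xs.
Proof.
by move=> y; rewrite ler_pM2l ?invr_gt0//; apply: ler_sum => i _; exact: xs_min.
Qed.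

Lemma sum_sps_step_le x :
  \sum_(i < n.+1) enorm (x - sps 2^-1 (f i) x *: grad (f i) x - xs) ^+ 2 <=
  n.+1%:R * rho * enorm (x - xs) ^+ 2.
Proof.
have N0 : 0 < n.+1%:R :> R by rewrite ltr0n.
apply: le_trans (_ : _ <= \sum_(i < n.+1)
    (enorm (x - xs) ^+ 2 - 2 / L * (f i x - f i xs))) _.
  by apply: ler_sum => i _; exact: sps_step_le.
have := strongly_convex_minimizer x favg_sc favg_minimizer.
rewrite /favg -mulrBr sumrB sumr_const card_ord -mulr_sumr sumrB.
set Q := enorm _ ^+ 2; set S := _ - _.
rewrite ler_pdivlMl// -(mulr_natl Q) => H.
have := ler_wpM2l (ltW (divr_gt0 (@ltr0Sn R 1) L_gt0)) H; rewrite /rho.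
have -> : 2 / L * (n.+1%:R * (mu / 2 * Q)) = n.+1%:R * (mu / L * Q).
  by field; rewrite (gt_eqF L_gt0).
lra.
Qed.

(* [rho] is nonnegative because it bounds a nonnegative average. *)
Lemma rho_ge0 x : 0 < enorm (x - xs) ^+ 2 -> 0 <= rho.
Proof.
move=> x0; have N0 : 0 < n.+1%:R :> R by rewrite ltr0n.
rewrite -(pmulr_rge0 _ N0) -(pmulr_lge0 _ x0).
by apply: le_trans (sum_sps_step_le x); apply: sumr_ge0 => i _; exact: sqr_ge0.
Qed.

(** Induction on [k] for all starting points at once: the first index is split off, and the
    induction hypothesis applies from the point it leads to. The sign of [rho] lets the one-step
    bound be multiplied by the [k]-th power. *)
Lemma sum_sgd_sps_le k x0 : 0 <= rho ->
  \sum_(s : k.-tuple 'I_n.+1)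
    enorm (sgd f (sps 2^-1) x0 (nth ord0 s) k - xs) ^+ 2 <=
  (n.+1%:R * rho) ^+ k * enorm (x0 - xs) ^+ 2.
Proof.
move=> rho0; elim: k x0 => [|k IH] x0.
  by rewrite expr0 mul1r /= sumr_const card_tuple.
rewrite big_tupleS.
apply: le_trans (_ : _ <= \sum_(i < n.+1) (n.+1%:R * rho) ^+ k *
    enorm (x0 - sps 2^-1 (f i) x0 *: grad (f i) x0 - xs) ^+ 2) _.
  apply: ler_sum => i _; apply: le_trans (IH _).
  by apply: ler_sum => s _; rewrite sgd_shift.
rewrite -mulr_sumr exprSr -mulrA ler_wpM2l ?sum_sps_step_le//.
by rewrite exprn_ge0// mulr_ge0.
Qed.

End interpolation.

(** * Expectations that depend on finitely many indices *)

Lemma expectation_iid_uniform (R : realType) (n : nat) (disp : measure_display)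
    (T : measurableType disp) (P : probability T R) (I : nat -> T -> 'I_n.+1)
    (k : nat) (h : (nat -> 'I_n.+1) -> R) :
  iid_uniform P I -> (forall s, 0 <= h s) ->
  (forall s s', (forall j, (j < k)%N -> s j = s' j) -> h s = h s') ->
  ('E_P[fun w => h (I ^~ w)] =
  (n.+1%:R^-1 ^+ k * \sum_(s : k.-tuple 'I_n.+1) h (nth ord0 s))%R%:E)%E.
Proof.
case=> mI PI indep h0 hk.
(* The event that the first [k] indices are [s]. These events partition the space, and [h] is
   constant on each; the padding of [s] by [ord0] is harmless by [hk]. *)
pose E (s : k.-tuple 'I_n.+1) :=
  \bigcap_(j in [set` iota 0 k]) (I j @^-1` [set nth ord0 s j]).
have mE s : measurable (E s) by apply: bigcap_measurableType => j _; exact: mI.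
have PE s : P (E s) = (n.+1%:R^-1 ^+ k)%:E.
  rewrite indep ?iota_uniq// (eq_bigr (fun=> (n.+1%:R^-1)%:E)); last first.
    by move=> j _; exact: PI.
  (* The start of [iota] is generalized, since it moves in the induction. *)
  elim: (k) 0%N => [|m IH] i; first by rewrite big_nil expr0.
  by rewrite /= big_cons IH exprS EFinM.
have hE w : (h (I ^~ w))%:E =
    (\sum_(s : k.-tuple 'I_n.+1) (h (nth ord0 s))%:E * (\1_(E s) w)%:E)%E.
  (* The only tuple whose event contains [w]. *)
  pose s0 := [tuple I j w | j < k].
  have s0E j : (j < k)%N -> nth ord0 s0 j = I j w.
    by move=> jk; rewrite -(tnth_nth ord0 s0 (Ordinal jk)) tnth_mktuple.
  rewrite (bigD1 s0)//= big1 => [|s ss0].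
    rewrite indicE mem_set ?mule1 ?adde0; first by congr EFin; apply: hk => j /s0E.
    by move=> j /=; rewrite mem_iota add0n => /andP[_ /s0E].
  rewrite indicE memNset ?mule0// => Ew; move/eqP: ss0; apply.
  apply: eq_from_tnth => j; rewrite tnth_mktuple (tnth_nth ord0).
  by rewrite -(Ew j)//= mem_iota add0n ltn_ord.
rewrite expectation.unlock; under eq_integral do rewrite hE.
rewrite ge0_integral_sum//=; last 2 first.
- move=> s; apply: measurable_funeM; apply/measurable_realfun.measurable_EFinP.
  exact: measurable_realfun.measurable_indic.
- by move=> s w _; rewrite mule_ge0 ?lee_fin.
rewrite mulr_sumr -sumEFin; apply: eq_bigr => s _.
rewrite ge0_integralZl_EFin//=; last first.
  apply/measurable_realfun.measurable_EFinP.
  exact: measurable_realfun.measurable_indic.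
by rewrite integral_indic// setIT -[X in (_ * X)%E]/(P (E s)) PE -EFinM mulrC.
Qed.

Theorem corollary3p2 (R : realType) (n d : nat)
    (f : 'I_n.+1 -> 'rV[R]_d -> R) (L : 'I_n.+1 -> R) (mu : R)
    (xs x0 : 'rV[R]_d)
    (disp : measure_display) (T : measurableType disp) (P : probability T R)
    (I : nat -> T -> 'I_n.+1)
    (f_convex : forall i, convex_function [set: 'rV[R]_d] (f i))
    (f_smooth : forall i, smooth (L i) (f i))
    (f_lbound : forall i, has_lbound (range (f i)))
    (mu_gt0 : 0 < mu)
    (favg_strongly_convex : strongly_convex mu (favg f))
    (xs_min : minimizer (favg f) xs)
    (interpolation : sigma2 f xs = 0)
    (I_iid : iid_uniform P I) :
  let Lmax := \big[Num.max/L ord0]_(i < n.+1) L i in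
  forall k : nat,
    ('E_P[fun w : T => (enorm (sgd f (sps 2^-1) x0 (I ^~ w) k - xs) ^+ 2)%R] <=
     ((1 - mu / Lmax) ^+ k * enorm (x0 - xs) ^+ 2)%:E)%E.
Proof.
move=> Lmax k; set gamma := sps 2^-1.
have dist_ge0 x : 0 <= enorm (x - xs) ^+ 2 by exact: sqr_ge0.
have N0 : 0 < n.+1%:R^-1 :> R by rewrite invr_gt0.
have infval_le i y : infval (f i) <= f i y by apply: ge_inf => //; exists y.
have xs_inf i : f i xs = infval (f i).
  (* A vanishing sum of nonnegative gaps has only zero terms. *)
  move/eqP: interpolation; rewrite mulf_eq0 (gt_eqF N0)/= => /eqP.
  move/psumr_eq0P => fE; apply/eqP; rewrite -subr_eq0 fE// => j _.
  by rewrite subr_ge0.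
have fi_min i : minimizer (f i) xs by move=> y; rewrite xs_inf.
rewrite (@expectation_iid_uniform _ _ _ _ _ _ k
  (fun s => enorm (sgd f gamma x0 s k - xs) ^+ 2))//; last first.
  by move=> s s' ss'; rewrite (sgd_ext _ _ _ ss').
rewrite lee_fin.
(* If every point is at distance [0] from [xs], i.e. if [d = 0], both sides
   vanish; [Lmax] may then be negative. *)
have [[x xxs]|/forallNP xs_all] :=
    pselect (exists x, 0 < enorm (x - xs) ^+ 2); last first.
  have dist0 x : enorm (x - xs) ^+ 2 = 0.
    by apply/eqP; rewrite eq_le dist_ge0 andbT leNgt; apply/negP; exact: xs_all.
  by rewrite dist0 mulr0 big1 ?mulr0.
have le_Lmax i : L i <= Lmax by exact: le_bigmax.
(* The sign of [Lmax] is not yet known, so the contraction is first used with any positive [L']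
   above it. Taking the maximum of [Lmax] and [mu / 2] then yields [mu <= Lmax], because
   [mu / 2 < mu]. *)
have mu_le L' : 0 < L' -> Lmax <= L' -> mu <= L'.
  move=> L'0 LL'.
  have sf i : smooth L' (f i) by exact: smooth_le (le_trans (le_Lmax i) LL') _.
  have := rho_ge0 f_convex L'0 sf favg_strongly_convex fi_min xs_inf xxs.
  by rewrite subr_ge0 ler_pdivrMr// mul1r.
have muL : mu <= Lmax.
  have := mu_le (Num.max Lmax (mu / 2)).
  rewrite lt_max le_max lexx divr_gt0//= orbT => /(_ isT isT).
  by rewrite le_max => /orP[//|]; lra.
have L0 : 0 < Lmax by exact: lt_le_trans muL.
have sf i : smooth Lmax (f i) by exact: smooth_le (le_Lmax i) _.
have rho0 : 0 <= 1 - mu / Lmax by rewrite subr_ge0 ler_pdivrMr// mul1r.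
have := sum_sgd_sps_le f_convex L0 sf favg_strongly_convex fi_min xs_inf k x0 rho0.
(* The weight of each tuple cancels the power of [n.+1] in the summed bound. *)
move/(ler_wpM2l (exprn_ge0 k (ltW N0))).
by rewrite mulrA -exprMn mulKf// pnatr_eq0.
Qed.
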